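(* Let $A\in\mathbb{R}^{m\times p}$ have no zero rows, let $B\in\mathbb{R}^{q\times n}$ have full column rank with QR decomposition $B=QR$, let $C\in\mathbb{R}^{m\times n}$, $\widehat C=CR^{-1}$, and let $\alpha\neq 0$. One cycle $X^s\mapsto X^{s+1}$ of the BK method for $AXQ=\widehat C$ (defined in the context) can be written as $$X^{s+1}=X^s+A^TL_\alpha^{-1}\,(\widehat C-AX^sQ)\,Q^T,\qquad L_\alpha=\mathrm{slt}(AA^T)+\alpha^{-1}\,\mathrm{diag}(AA^T),$$ where $\mathrm{slt}(AA^T)$ and $\mathrm{diag}(AA^T)$ denote the strictly lower triangular part and the diagonal part of the square matrix $AA^T$, respectively.
   Context: $M_{i,:}$ denotes the $i$th row of a matrix $M$ (a row vector), $A_{i,:}^T$ the transpose of the $i$th row of $A$, and $\|\cdot\|$ the 2-norm. In the decomposition $B=QR$, $Q\in\mathbb{R}^{q\times n}$ has orthonormal columns and $R\in\mathbb{R}^{n\times n}$ is upper triangular (and nonsingular, as $B$ has full column rank). The equation $AXB=C$ is then rewritten as $AXQ=\widehat C$ with $\widehat C=CR^{-1}$. BK method with $B$ of full column rank (relaxation parameter $\alpha$, initial guess $X^0\in\mathbb{R}^{p\times q}$): for $s=0,1,2,\dots$, set $X^{s,0}=X^s$; compute $$X^{s,i}=X^{s,i-1}+\frac{\alpha}{\|A_{i,:}\|^2}\,A_{i,:}^T\,\big(\widehat C_{i,:}-A_{i,:}X^{s,i-1}Q\big)Q^T,\qquad i=1,\dots,m;$$ set $X^{s+1}=X^{s,m}$.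 One such pass $X^s\mapsto X^{s+1}$ through all $m$ rows is called a cycle (or sweep). *)

(* Defs.v *)
(* The real numbers are generalized to an arbitrary real closed field K. *)
From HB Require Import structures.
From mathcomp Require Import all_boot all_order all_algebra.

Set Implicit Arguments.
Unset Strict Implicit.
Unset Printing Implicit Defensive.

Import Order.TTheory GRing.Theory Num.Theory.
Local Open Scope ring_scope.

Definition norm2 (K : rcfType) (k : nat) (v : 'rV[K]_k) : K :=
  Num.sqrt (\sum_(j < k) v 0 j ^+ 2).

Definition slt_mx (K : rcfType) (m : nat) (M : 'M[K]_m) : 'M[K]_m :=
  \matrix_(i, j) if (j < i)%N then M i j else 0.

Definition diag_part (K : rcfType) (m : nat) (M : 'M[K]_m) : 'M[K]_m :=
  diag_mx (\row_i M i i).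

(* MathComp's is_trig_mx means LOWER triangular, hence the transpose. *)
Definition is_QR (K : rcfType) (q n : nat)
    (B Q : 'M[K]_(q, n)) (R : 'M[K]_n) : Prop :=
  [/\ Q^T *m Q = 1%:M, is_trig_mx R^T & B = Q *m R].

Definition bk_step (K : rcfType) (m p q n : nat) (alpha : K)
    (A : 'M[K]_(m, p)) (Q : 'M[K]_(q, n)) (Chat : 'M[K]_(m, n))
    (i : 'I_m) (X : 'M[K]_(p, q)) : 'M[K]_(p, q) :=
  X + (alpha / norm2 (row i A) ^+ 2) *:
        ((row i A)^T *m (row i Chat - row i A *m X *m Q) *m Q^T).

(* enum 'I_m lists the row indices in increasing order. *)
Definition bk_cycle (K : rcfType) (m p q n : nat) (alpha : K)
    (A : 'M[K]_(m, p)) (Q : 'M[K]_(q, n)) (Chat : 'M[K]_(m, n))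
    (X : 'M[K]_(p, q)) : 'M[K]_(p, q) :=
  foldl (fun Y i => bk_step alpha A Q Chat i Y) X (enum 'I_m).

Definition bk_iter (K : rcfType) (m p q n : nat) (alpha : K)
    (A : 'M[K]_(m, p)) (Q : 'M[K]_(q, n)) (Chat : 'M[K]_(m, n))
    (X0 : 'M[K]_(p, q)) (s : nat) : 'M[K]_(p, q) :=
  iter s (bk_cycle alpha A Q Chat) X0.

Definition L_mx (K : rcfType) (m p : nat) (alpha : K)
    (A : 'M[K]_(m, p)) : 'M[K]_m :=
  slt_mx (A *m A^T) + alpha^-1 *: diag_part (A *m A^T).

(* Main.v *)
Require Import Defs.
From HB Require Import structures.
From mathcomp Require Import all_boot all_order all_algebra.

Set Implicit Arguments.
Unset Strict Implicit.
Unset Printing Implicit Defensive.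

Import Order.TTheory GRing.Theory Num.Theory.
Local Open Scope ring_scope.

(** A cycle is forward substitution in disguise.  Write [G = Chat - A X Q] for
    the residual at the start of the cycle and let [D] solve [L_alpha D = G].
    The claim is that the step for row [i] adds exactly [A_i^T D_i Q^T] to the
    iterate.  Indeed, if the earlier steps added [A_j^T D_j Q^T] for [j < i],
    then, since [Q^T Q = 1], the residual row used in step [i] is
    [G_i - \sum_(j < i) (A A^T)_ij D_j], and row [i] of the lower triangular
    system [L_alpha D = G] says that this equals [alpha^-1 |A_i|^2 D_i]; the
    factor [alpha / |A_i|^2] of the step turns it into [D_i].  Summing over all
    rows gives the total update [A^T D Q^T] ([bk_cycle_solution]).

    The system is solvable because [L_alpha] is triangular with diagonal
    entries [alpha^-1 |A_i|^2], which are nonzero when no row of [A] vanishes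
    ([L_mx_unit]). *)

Lemma norm2_sqr (K : rcfType) (k : nat) (v : 'rV[K]_k) :
  norm2 v ^+ 2 = \sum_(j < k) v 0 j ^+ 2.
Proof. by rewrite sqr_sqrtr // sumr_ge0 // => j _; exact: sqr_ge0. Qed.

Lemma norm2_sqr_eq0 (K : rcfType) (k : nat) (v : 'rV[K]_k) :
  (norm2 v ^+ 2 == 0) = (v == 0).
Proof.
rewrite norm2_sqr psumr_eq0 => [|j _]; last exact: sqr_ge0.
apply/allP/eqP => [v0 | -> j _]; last by rewrite mxE expr0n eqxx.
apply/rowP => j; rewrite mxE; apply/eqP.
by have:= v0 j (mem_index_enum j); rewrite /= sqrf_eq0.
Qed.

Lemma gram_diag (K : rcfType) (m p : nat) (A : 'M[K]_(m, p)) (i : 'I_m) :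
  (A *m A^T) i i = norm2 (row i A) ^+ 2.
Proof. by rewrite norm2_sqr mxE; apply: eq_bigr => k _; rewrite !mxE expr2. Qed.

Lemma L_mxE (K : rcfType) (m p : nat) (alpha : K) (A : 'M[K]_(m, p))
    (i j : 'I_m) :
  L_mx alpha A i j = (if (j < i)%N then (A *m A^T) i j else 0)
                     + (alpha^-1 * norm2 (row i A) ^+ 2) *+ (i == j).
Proof. by rewrite -gram_diag /L_mx !mxE mulrnAr. Qed.

Lemma L_mx_unit (K : rcfType) (m p : nat) (alpha : K) (A : 'M[K]_(m, p)) :
  alpha != 0 -> (forall i, row i A != 0) -> L_mx alpha A \in unitmx.
Proof.
move=> alpha0 A0; rewrite unitmxE det_trig.
  rewrite unitfE; apply/prodf_neq0 => i _.
  by rewrite L_mxE ltnn add0r eqxx mulf_neq0 ?invr_eq0 ?norm2_sqr_eq0.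
apply/is_trig_mxP => i j ltij.
by rewrite L_mxE ltnNge (ltnW ltij) -val_eqE ltn_eqF // addr0.
Qed.

Lemma row_L_mx_mul (K : rcfType) (m p n : nat) (alpha : K)
    (A : 'M[K]_(m, p)) (D : 'M[K]_(m, n)) (i : 'I_m) :
  row i (L_mx alpha A *m D) =
    \sum_(j < m | (j < i)%N) (A *m A^T) i j *: row j D
    + (alpha^-1 * norm2 (row i A) ^+ 2) *: row i D.
Proof.
rewrite row_mul mulmx_sum_row.
under eq_bigr => j _ do rewrite mxE L_mxE scalerDl.
rewrite big_split /= [X in _ + X](bigD1 i) //= eqxx [X in _ + (_ + X)]big1.
  rewrite addr0 [in RHS]big_mkcond /=; congr (_ + _).
  by apply: eq_bigr => j _; case: ifP => //; rewrite scale0r.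
by move=> j neji; rewrite eq_sym (negPf neji) scale0r.
Qed.

Lemma mulmx_sum_col_row (K : rcfType) (m p n : nat)
    (A : 'M[K]_(m, p)) (D : 'M[K]_(m, n)) :
  A^T *m D = \sum_(j < m) (row j A)^T *m row j D.
Proof.
apply/matrixP => a b; rewrite summxE mxE; apply: eq_bigr => j _.
by rewrite [RHS]mxE big_ord1 !mxE.
Qed.

(** Loop invariant rule, by induction on the prefixes of the enumeration: it
    reduces a whole cycle to a claim about one step. *)
Lemma foldl_enum_ord (T : Type) (m : nat) (f : T -> 'I_m -> T) (S : nat -> T) :
  (forall i : 'I_m, f (S i) i = S i.+1) -> foldl f (S 0%N) (enum 'I_m) = S m.
Proof.
move=> stepS.
have prefix k : (k <= m)%N -> foldl f (S 0%N) (take k (enum 'I_m)) = S k.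
  elim: k => [|k IHk] ltkm; first by rewrite take0.
  rewrite (take_nth (Ordinal ltkm)) ?size_enum_ord // foldl_rcons.
  by rewrite IHk ?(ltnW ltkm) // (nth_ord_enum _ (Ordinal ltkm)) (stepS (Ordinal ltkm)).
by rewrite -(prefix m) // take_oversize // size_enum_ord.
Qed.

(** The loop invariant of a cycle started at [X]: the iterate after [k] steps,
    provided that [L_alpha D = Chat - A X Q]. *)
Definition partial_update (K : rcfType) (m p q n : nat) (A : 'M[K]_(m, p))
    (Q : 'M[K]_(q, n)) (D : 'M[K]_(m, n)) (X : 'M[K]_(p, q)) (k : nat) :=
  X + (\sum_(j < m | (j < k)%N) (row j A)^T *m row j D) *m Q^T.

(** The step for row [i] is one forward substitution step: orthonormality of
    [Q] makes the residual row depend on the earlier updates only through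
    [A A^T], and row [i] of [L_alpha D = Chat - A X Q] evaluates it. *)
Lemma bk_step_partial_update (K : rcfType) (m p q n : nat) (alpha : K)
    (A : 'M[K]_(m, p)) (Q : 'M[K]_(q, n)) (Chat D : 'M[K]_(m, n))
    (X : 'M[K]_(p, q)) (i : 'I_m) :
  alpha != 0 -> row i A != 0 -> Q^T *m Q = 1%:M ->
  L_mx alpha A *m D = Chat - A *m X *m Q ->
  bk_step alpha A Q Chat i (partial_update A Q D X i)
    = partial_update A Q D X i.+1.
Proof.
move=> alpha0 Ai0 QTQ LD.
have residual : row i Chat - row i A *m partial_update A Q D X i *m Q
    = (alpha^-1 * norm2 (row i A) ^+ 2) *: row i D.
  rewrite /partial_update mulmxDr mulmxDl -!mulmxA QTQ mulmx1 !mulmxA opprD addrA.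
  rewrite -[row i A *m X]row_mul -row_mul -linearB /= -LD row_L_mx_mul.
  rewrite mulmx_sumr addrAC -[RHS]add0r; congr (_ + _).
  apply/eqP; rewrite subr_eq0; apply/eqP; apply: eq_bigr => j _.
  rewrite mulmxA [row i A *m _]mx11_scalar mul_scalar_mx; congr (_ *: _).
  by rewrite !mxE; apply: eq_bigr => k _; rewrite !mxE.
rewrite /bk_step residual -scalemxAr -scalemxAl scalerA.
have -> : alpha / norm2 (row i A) ^+ 2 * (alpha^-1 * norm2 (row i A) ^+ 2) = 1.
  by rewrite mulrACA divff // mulVf ?mulr1 ?norm2_sqr_eq0.
rewrite scale1r /partial_update -addrA -mulmxDl; congr (_ + _ *m _).
rewrite [RHS](bigD1 i) //= addrC; congr (_ + _); apply: eq_bigl => j.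
by rewrite ltnS -val_eqE /= andbC ltn_neqAle.
Qed.

Lemma bk_cycle_solution (K : rcfType) (m p q n : nat) (alpha : K)
    (A : 'M[K]_(m, p)) (Q : 'M[K]_(q, n)) (Chat D : 'M[K]_(m, n))
    (X : 'M[K]_(p, q)) :
  alpha != 0 -> (forall i, row i A != 0) -> Q^T *m Q = 1%:M ->
  L_mx alpha A *m D = Chat - A *m X *m Q ->
  bk_cycle alpha A Q Chat X = X + A^T *m D *m Q^T.
Proof.
move=> alpha0 A0 QTQ LD.
have start : X = partial_update A Q D X 0.
  by rewrite /partial_update big_pred0 // mul0mx addr0.
rewrite /bk_cycle {1}start (foldl_enum_ord (S := partial_update A Q D X)).
  rewrite /partial_update mulmx_sum_col_row; congr (_ + _ *m _).
  by apply: eq_bigl => j; rewrite ltn_ord.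
by move=> i; apply: bk_step_partial_update.
Qed.

Theorem proposition3p3 (K : rcfType) (m p q n : nat)
    (A : 'M[K]_(m, p)) (B : 'M[K]_(q, n)) (C : 'M[K]_(m, n))
    (Q : 'M[K]_(q, n)) (R : 'M[K]_n) (alpha : K)
    (hA : forall i : 'I_m, row i A != 0)
    (hB : \rank B = n)
    (hQR : is_QR B Q R)
    (halpha : alpha != 0)
    (X0 : 'M[K]_(p, q)) (s : nat) :
  let Chat := C *m invmx R in
  let X := bk_iter alpha A Q Chat X0 in
  L_mx alpha A \in unitmx /\
  X s.+1 = X s + A^T *m invmx (L_mx alpha A) *m (Chat - A *m X s *m Q) *m Q^T.
Proof.
move=> Chat X; case: hQR => QTQ _ _.
have Lunit := L_mx_unit halpha hA.
split=> //; rewrite -[A^T *m _ *m _]mulmxA.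
by apply: bk_cycle_solution => //; rewrite mulKVmx.
Qed.
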